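(* Let $m$ be a positive integer, let $B$ be a singleton board, let $N=|B|+1$, and write $B=(b_1,\dots,b_N)$ by padding with columns of height $0$ on the left. Let $n(\zeta_m(B))=(n_0,n_1,\dots)$. Then the number of singleton boards which are $m$-level rook equivalent to $B$ is $$ \prod_{i\ge0} \binom{n_{im}+n_{im+1}+\dots+n_{im+m}-1}{n_{im}-1,\,n_{im+1},\,n_{im+2},\,\dots,\,n_{im+m}}. $$
   Context: A Ferrers board $B=(b_1,\dots,b_n)$ ($0\le b_1\le\dots\le b_n$ integers) is the set of the $b_j$ lowest cells of column $j$ in the first-quadrant grid; boards are regarded as sets of cells, so sequences differing only by left columns of height $0$ are the same board; $|B|$ is its number of cells. $\lfloor n\rfloor_m$ is the largest multiple of $m$ that is $\le n$ and $\rho_m(n)=n-\lfloor n\rfloor_m$. $B$ is a singleton board if for all $i<n$, $\lfloor b_i\rfloor_m\ne b_i$ implies $\lfloor b_{i+1}\rfloor_m>\lfloor b_i\rfloor_m$. An $m$-zone is a maximal interval $z=[s,t]$ of column indices with $\lfloor b_s\rfloor_m=\dots=\lfloor b_t\rfloor_m$, and $\rho_m(z)=\sum_{j\in z}\rho_m(b_j)$. The $m$-level root vector is $\zeta_m(B)=(a_1,\dots,a_n)$ with $a_j=(j-1)m-\lfloor b_j\rfloor_m-\rho_m(z)$ if $j$ is last in its zone $z$, and $a_j=(j-1)m-\lfloor b_j\rfloor_m$ otherwise. For a finite vector $\nu$ of nonnegative integers, $n(\nu)=(n_0,n_1,\dots)$ where $n_i$ is the number of entries of $\nu$ equal to $i$.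 The $i$th level is rows $(i-1)m+1,\dots,im$; an $m$-level rook placement is a set of cells no two in the same level or column; $r_{k,m}(B)$ counts those with $k$ cells; $B,B'$ are $m$-level rook equivalent if $r_{k,m}(B)=r_{k,m}(B')$ for all $k$. *)

(* Defs.v *)
From HB Require Import structures.
From mathcomp Require Import all_boot all_order all_algebra.

Set Implicit Arguments.
Unset Strict Implicit.
Unset Printing Implicit Defensive.

(* Columns and rows are numbered from 0. *)

(* A board is stored without its columns of height 0, so that each set of     *)
(* cells is represented exactly once; [pad] restores the empty left columns.  *)
Definition is_board (b : seq nat) : bool := sorted leq b && (0 \notin b).

Record board := Board { heights :> seq nat; _ : is_board heights }.

HB.instance Definition _ := [isSub for heights].
HB.instance Definition _ := [Countable of board by <:].

Definition area (b : seq nat) : nat := sumn b.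

Definition pad (n : nat) (b : seq nat) : seq nat := nseq (n - size b) 0 ++ b.

Definition floorm (m n : nat) : nat := n %/ m * m.

Definition rho (m n : nat) : nat := n - floorm m n.

Definition singleton (m : nat) (b : seq nat) : Prop :=
  forall i, i.+1 < size b ->
    floorm m (nth 0 b i) <> nth 0 b i ->
    floorm m (nth 0 b i) < floorm m (nth 0 b i.+1).

Section RootVector.

Variables (m : nat) (b : seq nat).

(* The maximal interval of columns around [j] on which the floors are those   *)
(* of column [j].                                                             *)
Definition zone (j : 'I_(size b)) : {set 'I_(size b)} :=
  [set k : 'I_(size b) | [forall l : 'I_(size b),
     (minn j k <= l <= maxn j k) ==>
       (floorm m (nth 0 b l) == floorm m (nth 0 b j))]].

Definition zone_rho (z : {set 'I_(size b)}) : nat :=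
  \sum_(k in z) rho m (nth 0 b k).

Definition last_in_zone (j : 'I_(size b)) : bool :=
  [forall k in zone j, k <= j].

(* Integer valued: the entries can be negative if [b] is not padded enough. *)
Definition root_vector : {ffun 'I_(size b) -> int} :=
  [ffun j : 'I_(size b) =>
     ((j * m)%N%:Z - (floorm m (nth 0 b j))%N%:Z
      - (if last_in_zone j then zone_rho (zone j) else 0)%N%:Z)%R].

End RootVector.

Definition mult_of (n : nat) (nu : {ffun 'I_n -> int}) (i : nat) : nat :=
  #|[set j | (nu j == i%:Z)%R]|.

Section Rooks.

Variables (m : nat) (b : seq nat).

Definition cell : finType := ('I_(size b) * 'I_(\max_(h <- b) h))%type.

Definition cells : {set cell} := [set c : cell | c.2 < nth 0 b c.1].

Definition level (c : cell) : nat := c.2 %/ m.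

Definition rook_placement (P : {set cell}) : bool :=
  (P \subset cells) &&
  [forall c in P, forall d in P,
     (c != d) ==> (c.1 != d.1) && (level c != level d)].

Definition rook_number (k : nat) : nat :=
  #|[set P : {set cell} | rook_placement P & #|P| == k]|.

End Rooks.

Definition rook_equiv (m : nat) (b b' : seq nat) : Prop :=
  forall k, rook_number m b k = rook_number m b' k.

Definition multinomial (n : nat) (s : seq nat) : nat :=
  if sumn s == n then n`! %/ \prod_(k <- s) k`! else 0.

(* The multinomial coefficient with top [c 0 + ... + c m - 1] and bottom      *)
(* [c 0 - 1, c 1, ..., c m], where [c t = n_(i m + t)].  Predecessors are     *)
(* truncated: if all [c t] vanish, the coefficient, with top -1 and bottom    *)
(* [-1, 0, ..., 0], is 1; if only [c 0] vanishes, the bottom no longer sums   *)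
(* to the top and the coefficient is 0.                                       *)
Definition zeta_factor (m n : nat) (nu : {ffun 'I_n -> int}) (i : nat) : nat :=
  multinomial (\sum_(0 <= t < m.+1) mult_of nu (i * m + t)).-1
    ((mult_of nu (i * m)).-1 :: [seq mult_of nu (i * m + t) | t <- iota 1 m]).

(* Main.v *)
Require Import Defs.
From mathcomp Require Import all_boot all_order all_algebra.
From mathcomp Require Import zify ring.

(* On a singleton board the root vector is a_j = j m - b_j.  Placing rooks    *)
(* column by column, k rooks in the earlier columns block exactly k m cells   *)
(* of column j, so that sum_k r_k x(x-m)...(x-(n-k-1)m) = prod_j (x - a_j),   *)
(* and rook equivalence means that the root vectors are rearrangements of     *)
(* each other.  A word with a_0 = 0 is the root vector of a singleton board   *)
(* iff a_{j+1} <= m (floor(a_j / m) + 1) for all j.  Such words are counted   *)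
(* by inserting the letters in increasing order: the k copies of a largest    *)
(* letter x = i m + t (0 < t <= m) may follow any letter >= i m, and if there *)
(* are L letters in [i m, x), this gives binomial(L + k - 1, k) insertions;   *)
(* the binomials for t = 1, ..., m multiply to the i-th multinomial.          *)

Set Implicit Arguments.
Unset Strict Implicit.
Unset Printing Implicit Defensive.

Import Order.TTheory GRing.Theory Num.Theory.

(** * Rook placements column by column *)

(** On a singleton board every column that is not last in its zone has height divisible by [m], so
    the zone correction just replaces the floor by the height and the roots are a_j = j m - b_j
    ([root_vectorE]). A rook in an earlier column blocks a full level, that is [m] cells, of each
    later column ([card_free_rows]). The resulting recurrence [card_placementsS] makes the rook
    polynomial, written in the basis x (x - m) (x - 2m) ..., split into the factors x - a_j
    ([rook_rec_factor]). Independence of the basis and unique factorization then identify rook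
    equivalence with equality of the multisets of roots ([rook_equivP]).

    Equivalent boards have the same area, so with |B| + 1 columns all of them have nonnegative
    roots, the first being 0. The requirements on two successive columns amount to a bound on the
    next root by [shift] of the current one ([board_step]). Hence the boards sought correspond to
    the rearrangements of the roots of B that satisfy this local bound ([card_equiv_boards]).

    Such words are built by inserting letters in increasing order. The slots open to x = i m + t,
    with 0 < t <= m, are those after letters in [i m, x), so each letter contributes a binomial
    coefficient ([size_words]), and the binomials of one block of [m] letters telescope to a
    multinomial coefficient ([multinomialE], [size_root_words]). *)

Lemma sum_ltn_ord (H h : nat) : h <= H -> \sum_(r < H) (r < h : nat) = h.
Proof.
move=> hH; rewrite -(big_mkord xpredT (fun r => (r < h : nat))) /=.
rewrite (big_cat_nat (leq0n h) hH) /=.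
rewrite (eq_big_nat _ _ (F2 := fun=> 1)); last by move=> i /andP[_ ->].
rewrite [X in _ + X]big1_seq; first by rewrite sum_nat_const_nat subn0 muln1 addn0.
by move=> i; rewrite mem_index_iota => /andP[_ /andP[hi _]]; rewrite ltnNge hi.
Qed.

Lemma sum_divn_eq (m H l : nat) :
  0 < m -> l.+1 * m <= H -> \sum_(r < H) (l == r %/ m : nat) = m.
Proof.
move=> m0 lH.
have E : \sum_(r < H) (l == r %/ m : nat) + \sum_(r < H) (r < l * m : nat)
   = \sum_(r < H) (r < l.+1 * m : nat).
  rewrite -big_split /=; apply: eq_bigr => r _.
  by rewrite -!ltn_divLR // ltnS; case: ltngtP.
move: E; rewrite !sum_ltn_ord //; nia.
Qed.

Lemma sorted_nth_leq (b : seq nat) i j :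
  sorted leq b -> i <= j -> j < size b -> nth 0 b i <= nth 0 b j.
Proof.
move=> sb ij jb; apply: (sorted_leq_nth leq_trans leqnn 0 sb) => //.
by rewrite inE (leq_ltn_trans ij).
Qed.

Section PartialPlacements.

Variables (m : nat) (b : seq nat).
Hypotheses (m_gt0 : 0 < m) (b_sorted : sorted leq b) (b_sing : singleton m b).

Lemma rook_placementP (P : {set cell b}) :
  reflect ((forall c, c \in P -> c.2 < nth 0 b c.1) /\
           (forall c d, c \in P -> d \in P -> c != d ->
              c.1 != d.1 /\ level m c != level m d))
          (rook_placement m P).
Proof.
apply: (iffP andP) => -[H1 H2]; split.
- by move=> c /(subsetP H1); rewrite inE.
- move=> c d cP dP cd; move/forall_inP: H2 => /(_ c cP) /forall_inP /(_ d dP).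
  by rewrite cd => /andP.
- by apply/subsetP => c /H1; rewrite inE.
- apply/forall_inP => c cP; apply/forall_inP => d dP; apply/implyP => cd.
  exact/andP/H2.
Qed.

Definition placements (j k : nat) : {set {set cell b}} :=
  [set P | [&& rook_placement m P, [forall c in P, c.1 < j] & #|P| == k]].

Definition free_rows (j : nat) (Q : {set cell b}) : {set 'I_(\max_(h <- b) h)} :=
  [set r : 'I_(\max_(h <- b) h) |
     (r < nth 0 b j) && [forall d in Q, level m d != r %/ m]].

Lemma placements0 j : #|placements j 0| = 1.
Proof.
rewrite -(cards1 (set0 : {set cell b})); apply: eq_card => P; rewrite !inE.
apply/and3P/eqP => [[_ _]|->]; first by rewrite cards_eq0 => /eqP.
split; last by rewrite cards0.
- by apply/rook_placementP; split=> [c|c d]; rewrite inE.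
- by apply/forall_inP => c; rewrite inE.
Qed.

Lemma placements_no_column k : #|placements 0 k.+1| = 0.
Proof.
apply/eqP; rewrite cards_eq0; apply/eqP/setP => P; rewrite !inE.
apply/negP => /and3P[_ /forall_inP H /eqP cP].
have /card_gt0P[c /H //] : 0 < #|P| by rewrite cP.
Qed.

Lemma nth_leq_max j : nth 0 b j <= \max_(h <- b) h.
Proof.
have [jb|jb] := ltnP j (size b); last by rewrite nth_default.
by apply: (leq_bigmax_seq _ (F := id)); rewrite ?mem_nth.
Qed.

(* This is where the singleton condition is used. *)
Lemma level_below_column j (jb : j < size b) (d : cell b) :
  d.1 < j -> d.2 < nth 0 b d.1 -> (level m d).+1 * m <= nth 0 b j.
Proof.
move=> dj dh; rewrite /level -leq_divRL //.
set h := nth 0 b d.1 in dh *.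
have hj : h <= nth 0 b j by apply: sorted_nth_leq => //; exact: ltnW.
have [hm|hm] := eqVneq (floorm m h) h.
  apply: leq_trans (leq_div2r m hj).
  by rewrite ltn_divLR // -/(floorm m h) hm.
have lt1 : d.1.+1 < size b by apply: leq_ltn_trans jb.
have := b_sing lt1; rewrite -/h => /(_ (elimN eqP hm)).
rewrite /floorm ltn_pmul2r // => lt2.
apply: leq_ltn_trans (leq_div2r m (ltnW dh)) _.
apply: leq_trans lt2 _; apply: leq_div2r; exact: sorted_nth_leq.
Qed.

(** The [k] rooks lie in distinct levels, and by [level_below_column] all [m] rows of each of these
    levels belong to column [j]. So each row of the column is either free or in exactly one occupied
    level. *)
Lemma card_free_rows j k Q :
  j < size b -> Q \in placements j k -> #|free_rows j Q| + k * m = nth 0 b j.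
Proof.
move=> jb; rewrite inE => /and3P[/rook_placementP[Hc Hd] /forall_inP Hj /eqP <-].
rewrite -[RHS](sum_ltn_ord (nth_leq_max j)) -sum1_card big_mkcond /=.
have -> : #|Q| * m = \sum_(r < \max_(h <- b) h) \sum_(d in Q) (level m d == r %/ m).
  rewrite exchange_big /= -sum_nat_const; apply: eq_bigr => d dQ; apply/esym.
  apply: sum_divn_eq => //; apply: leq_trans (nth_leq_max j).
  exact: (level_below_column jb (Hj _ dQ) (Hc _ dQ)).
rewrite -big_split /=; apply: eq_bigr => r _; rewrite inE.
have [/forall_inP Hf|] := boolP [forall d in Q, level m d != r %/ m].
  by rewrite andbT [X in _ + X]big1 ?addn0 => [|d /Hf /negbTE ->] //; case: ltnP.
rewrite negb_forall_in => /exists_inP[d dQ /negPn dr].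
rewrite andbF add0n (bigD1 d) //= dr [X in _ + X]big1 => [|e /andP[eQ ed]]; last first.
  by case: eqP => // er; case: (Hd _ _ eQ dQ ed); rewrite er (eqP dr) eqxx.
have := level_below_column jb (Hj _ dQ) (Hc _ dQ).
rewrite (eqP dr) => /(leq_trans _) -> //; exact: ltn_ceil.
Qed.

(** Either column [j] stays empty, or the placement arises in exactly one way from a smaller one [Q]
    by adding a rook in a row free for [Q]. *)
Lemma card_placementsS j k : j < size b ->
  #|placements j.+1 k.+1| =
  #|placements j k.+1| + \sum_(Q in placements j k) #|free_rows j Q|.
Proof.
move=> jb; pose jo := Ordinal jb.
rewrite -(cardsID (placements j k.+1)); congr (_ + _).
  apply: eq_card => P; rewrite !inE.
  apply/andP/idP => [[]//|H]; split=> //.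
  case/and3P: H => -> /forall_inP Hj ->; rewrite andbT /=.
  by apply/forall_inP => c /Hj; exact: ltnW.
pose E := [set x : {set cell b} * 'I_(\max_(h <- b) h) |
   (x.1 \in placements j k) && (x.2 \in free_rows j x.1)].
have -> : \sum_(Q in placements j k) #|free_rows j Q| = #|E|.
  under eq_bigr do rewrite -sum1_card.
  by rewrite pair_big_dep -sum1_card; apply: eq_bigl => x; rewrite [in RHS]inE.
pose g (x : {set cell b} * 'I_(\max_(h <- b) h)) : {set cell b} :=
  (jo, x.2) |: x.1.
have notin x c : x \in E -> c \in x.1 -> c.1 != jo.
  rewrite inE => /andP[]; rewrite inE => /and3P[_ /forall_inP H _] _ /H.
  by rewrite -(inj_eq val_inj) neq_ltn /= => ->.
have gI : {in E &, injective g}.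
  move=> [Q r] [Q' r'] xE yE /= e.
  have er : r = r'.
    have : (jo, r) \in g (Q', r') by rewrite -e setU11.
    rewrite in_setU1 => /orP[/eqP[->]//|/(notin _ _ yE)]; by rewrite eqxx.
  congr (_, _) => //; subst r'.
  have nQ : (jo, r) \notin Q by apply/negP => /(notin _ _ xE); rewrite eqxx.
  have nQ' : (jo, r) \notin Q' by apply/negP => /(notin _ _ yE); rewrite eqxx.
  by rewrite -(setU1K nQ) -(setU1K nQ') -[_ |: Q]/(g (Q, r)) e.
rewrite -(card_in_imset gI); apply: eq_card => P.
apply/idP/imsetP.
  rewrite !inE => /andP[nA /and3P[pP /forall_inP Hj cP]].
  move: nA; rewrite pP cP andbT /= negb_forall_in => /exists_inP[c cin cj].
  have ec : c = (jo, c.2).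
    rewrite [LHS]surjective_pairing; congr (_, _); apply: val_inj => /=.
    by apply/eqP; rewrite eqn_leq -ltnS Hj //= leqNgt.
  have [Hc Hd] := rook_placementP _ pP.
  exists (P :\ c, c.2); last by rewrite /g /= -ec setD1K.
  rewrite !inE /=; apply/andP; split; last first.
    apply/andP; split; first by have := Hc _ cin; rewrite {2}ec.
    apply/forall_inP => d; rewrite !inE => /andP[dc dP].
    by case: (Hd _ _ dP cin dc).
  apply/and3P; split.
  - apply/rook_placementP; split=> [d|d e]; rewrite !inE; first by case/andP => _ /Hc.
    by case/andP=> _ dP /andP[_ eP]; apply: Hd.
  - apply/forall_inP => d; rewrite !inE => /andP[dc dP].
    have [ne _] := Hd _ _ dP cin dc.
    have := Hj _ dP; rewrite ltnS leq_eqVlt => /orP[/eqP ej|//].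
    by move: ne; rewrite ec /= -(inj_eq val_inj) /= ej eqxx.
  - by rewrite (cardsD1 c) cin add1n eqSS in cP.
case=> -[Q r] xE ->; have := xE; rewrite inE /= => /andP[].
rewrite [in X in X -> _]inE => /and3P[/rook_placementP[Hc Hd] /forall_inP Hj cQ].
rewrite inE => /andP[rj /forall_inP fr].
have nQ : (jo, r) \notin Q by apply/negP => /(notin _ _ xE); rewrite eqxx.
rewrite !inE; apply/andP; split.
  rewrite !negb_and; apply/orP; right; apply/orP; left.
  by rewrite negb_forall_in; apply/exists_inP; exists (jo, r); rewrite ?setU11 //= ltnn.
apply/and3P; split.
- apply/rook_placementP; split=> [c|c d].
    by rewrite in_setU1 => /orP[/eqP -> //|/Hc].
  rewrite !in_setU1 => /orP[/eqP ->|cin] /orP[/eqP ->|din].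
  + by rewrite eqxx.
  + by move=> _; rewrite eq_sym (notin _ _ xE din) eq_sym; split=> //; exact: fr.
  + by move=> _; rewrite (notin _ _ xE cin); split=> //; exact: fr.
  + exact: Hd.
- apply/forall_inP => c; rewrite in_setU1 => /orP[/eqP -> //=|/Hj]; exact: ltnW.
- by rewrite /g cardsU1 nQ add1n eqSS.
Qed.

End PartialPlacements.

(** * Factorization of the rook polynomial *)

Section RookPolynomial.

Local Open Scope ring_scope.

Variable m : nat.

(** The recurrence of [card_placementsS] with the free rows counted. Rational values avoid
    truncation when [h < k' * m]; on a sorted singleton board there is then no placement of [k']
    rooks, and the term is 0. *)
Definition add_column (f : nat -> rat) (h k : nat) : rat :=
  f k + if k is k'.+1 then (h%:R - (k' * m)%:R) * f k' else 0.

Definition rook_rec (b : seq nat) : nat -> rat :=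
  foldl add_column (fun k => (k == 0%N)%:R) b.

Lemma rook_rec_rcons b h : rook_rec (rcons b h) = add_column (rook_rec b) h.
Proof. by rewrite /rook_rec -cats1 foldl_cat. Qed.

Lemma rook_rec_large b k : (size b < k)%N -> rook_rec b k = 0.
Proof.
elim/last_ind: b k => [|b h IH] [|k] //.
rewrite size_rcons rook_rec_rcons ltnS => bk.
by rewrite /add_column !IH ?mulr0 ?addr0 // ltnW.
Qed.

Lemma rook_rec0 b : rook_rec b 0 = 1.
Proof.
elim/last_ind: b => [//|b h IH].
by rewrite rook_rec_rcons /add_column IH addr0.
Qed.

Lemma rook_rec1 b : rook_rec b 1 = (area b)%:R.
Proof.
elim/last_ind: b => [//|b h IH].
by rewrite rook_rec_rcons /add_column IH rook_rec0 /area sumn_rcons natrD subr0 mulr1.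
Qed.

Lemma rook_rec_pad n b k : rook_rec (pad n b) k = rook_rec b k.
Proof.
have ext s f g : f =1 g -> foldl add_column f s =1 foldl add_column g s.
  elim: s f g => [//|h s IH] f g fg /=.
  by apply: IH => -[|j]; rewrite /add_column !fg.
rewrite /rook_rec /pad foldl_cat; apply: ext => {k} j.
elim: (n - size b)%N j => [//|d IH] j; rewrite -[d.+1]addn1 nseqD foldl_cat /=.
by case: j => [|[|j]]; rewrite /add_column !IH /= ?addr0 ?subr0 ?mulr0 ?mul0r ?addr0.
Qed.

Lemma rook_number_rec b k : (0 < m)%N -> sorted leq b -> singleton m b ->
  (rook_number m b k)%:R = rook_rec b k.
Proof.
move=> m0 sb ib.
have -> : rook_number m b k = #|placements m b (size b) k|.
  apply: eq_card => P; rewrite !inE; congr (_ && _).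
  by rewrite (introT forall_inP) // => c _.
suff H j : (j <= size b)%N -> (#|placements m b j k|)%:R = rook_rec (take j b) k.
  by rewrite H // take_size.
elim: j k => [|j IH] k jb.
  by rewrite take0; case: k => [|k]; rewrite ?placements0 ?placements_no_column.
rewrite (take_nth 0%N jb) rook_rec_rcons /add_column.
case: k => [|k]; first by rewrite placements0 rook_rec0 addr0.
rewrite card_placementsS // natrD IH ?(ltnW jb) //; congr (_ + _).
rewrite natr_sum -IH ?(ltnW jb) //.
rewrite (eq_bigr (fun=> (nth 0%N b j)%:R - (k * m)%:R)).
  by rewrite sumr_const mulr_natr.
by move=> Q QP; rewrite -(card_free_rows m0 sb ib jb QP) natrD addrK.
Qed.

Definition falling (i : nat) : {poly rat} := \prod_(l < i) ('X - (l * m)%:R%:P).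

Lemma fallingS i : falling i.+1 = falling i * ('X - (i * m)%:R%:P).
Proof. by rewrite /falling big_ord_recr. Qed.

Lemma size_falling i : size (falling i) = i.+1.
Proof. by rewrite /falling size_prod_XsubC /index_enum -enumT size_enum_ord. Qed.

Lemma coef_falling i : (falling i)`_i = 1.
Proof.
have /monicP : falling i \is monic by apply: monic_prod => l _; exact: monicXsubC.
by rewrite lead_coefE size_falling.
Qed.

(** [falling i] is monic of degree [i], so the top coefficient isolates [c 0]; induction does the
    rest. *)
Lemma falling_free n (c : nat -> rat) :
  \sum_(k < n.+1) c k *: falling (n - k) = 0 -> forall k, (k <= n)%N -> c k = 0.
Proof.
elim: n c => [|n IH] c; rewrite big_ord_recl /= subn0.
  rewrite big_ord0 addr0 => /(congr1 (fun p : {poly rat} => p`_0)).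
  by rewrite coefZ coef_falling mulr1 coef0 => c0 [].
set S := \sum_(i < _) _ => E.
have SE : S = \sum_(k < n.+1) c k.+1 *: falling (n - k) by [].
have c0 : c 0%N = 0.
  move/(congr1 (fun p : {poly rat} => p`_n.+1)): E; rewrite coefD coefZ coef_falling mulr1 coef0.
  rewrite [S`__]nth_default ?addr0 // SE.
  apply: leq_trans (size_sum _ _ _) _; apply/bigmax_leqP => k _.
  by apply: leq_trans (size_scale_leq _ _) _; rewrite size_falling ltnS leq_subr.
move: E; rewrite c0 scale0r add0r SE => /(IH (fun k => c k.+1)) cS [|k] //; exact: cS.
Qed.

Definition rook_roots (b : seq nat) : seq rat :=
  [seq (j * m)%:R - (nth 0%N b j)%:R | j <- iota 0 (size b)].

Lemma rook_roots_rcons b h :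
  rook_roots (rcons b h) = rcons (rook_roots b) ((size b * m)%:R - h%:R).
Proof.
rewrite /rook_roots size_rcons -[(size b).+1]addn1 iotaD map_cat cats1 /=.
rewrite nth_rcons ltnn eqxx; congr rcons; apply/eq_in_map => j.
by rewrite mem_iota add0n /= => jb; rewrite nth_rcons jb.
Qed.

(** Placements of [k] rooks contribute twice to the next board, with the new column empty or filled.
    In the sum of the two contributions [k * p] cancels, leaving a linear factor independent of
    [k]. *)
Lemma column_identity (R : comNzRingType) (f e x n k p h : R) :
  f * (e * (x - (n - k) * p)) + (h - k * p) * f * e = f * e * (x - (n * p - h)).
Proof. by ring. Qed.

(** An [m]-level form of the Goldman-Joichi-White factorization: each new column multiplies the
    polynomial by the factor of [column_identity]. *)
Lemma rook_rec_factor b :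
  \sum_(k < (size b).+1) rook_rec b k *: falling (size b - k) =
  \prod_(x <- rook_roots b) ('X - x%:P).
Proof.
elim/last_ind: b => [|b h IH].
  by rewrite big_ord_recl !big_ord0 big_nil /falling big_ord0 scale1r addr0.
rewrite rook_roots_rcons big_rcons /= -IH size_rcons rook_rec_rcons.
set n := size b; rewrite /add_column.
under eq_bigr do rewrite scalerDl.
(* The last term of the first sum has more rooks than columns, and the first term of the second sum
   is 0; after an index shift both run over the same [k]. *)
rewrite big_split /= big_ord_recr /= rook_rec_large // scale0r addr0.
rewrite [X in _ + X]big_ord_recl /= scale0r add0r -big_split /= mulr_suml.
apply: eq_bigr => k _; rewrite /bump leq0n add1n subSS.
have kn : (k <= n)%N by rewrite -ltnS.
rewrite subSn // fallingS -!mul_polyC.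
rewrite natrM natrB // !rmorphB !rmorphM !rmorphB /= !polyC_natr !add0n.
rewrite rmorphM /= !polyC_natr.
exact: column_identity.
Qed.

Lemma size_pad n b : (size b <= n)%N -> size (pad n b) = n.
Proof. by move=> bn; rewrite size_cat size_nseq subnK. Qed.

(** Padding to a common length expresses both polynomials in the same basis. Left to right is unique
    factorization, right to left is [falling_free]. *)
Lemma rook_equivP n b b' : (0 < m)%N ->
  sorted leq b -> singleton m b -> sorted leq b' -> singleton m b' ->
  (size b <= n)%N -> (size b' <= n)%N ->
  rook_equiv m b b' <-> perm_eq (rook_roots (pad n b)) (rook_roots (pad n b')).
Proof.
move=> m0 sb ib sb' ib' bn bn'; split=> [E|E k].
  apply: prod_XsubC_eq; rewrite -!rook_rec_factor !size_pad //.
  apply: eq_bigr => k _.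
  by rewrite !rook_rec_pad -!rook_number_rec // E.
apply/eqP; rewrite -(eqr_nat rat) !rook_number_rec // -(rook_rec_pad n b) -(rook_rec_pad n b') -subr_eq0.
have [kn|kn] := leqP k n; last by rewrite !rook_rec_large ?size_pad // subr0.
apply/eqP; move: k kn.
apply: (falling_free (c := fun k => rook_rec (pad n b) k - rook_rec (pad n b') k)).
under eq_bigr do rewrite scalerBl.
rewrite sumrB; have := rook_rec_factor (pad n b); have := rook_rec_factor (pad n b').
by rewrite !size_pad // => -> ->; rewrite (perm_big _ E) /= subrr.
Qed.

(** The first rook number is the number of cells. *)
Lemma rook_equiv_area b b' : (0 < m)%N ->
  sorted leq b -> singleton m b -> sorted leq b' -> singleton m b' ->
  rook_equiv m b b' -> area b = area b'.
Proof.
move=> m0 sb ib sb' ib' E; apply/eqP; rewrite -(eqr_nat rat) -!rook_rec1.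
by rewrite -!rook_number_rec // E.
Qed.

End RookPolynomial.

(** * Counting words *)

Lemma size_fibers (T U : eqType) (f : T -> U) (s : seq T) (t : seq U) c :
  uniq t -> {in s, forall w, f w \in t} ->
  {in t, forall u, count (fun w => f w == u) s = c} -> size s = size t * c.
Proof.
move=> ut st ct.
have -> : size s = \sum_(u <- t) count (fun w => f w == u) s.
  under eq_bigr do rewrite -sum1_count.
  rewrite (exchange_big_dep xpredT) //= -sum1_size; apply: eq_big_seq => w /st ft.
  have E : eq_op (f w) =1 pred1 (f w) by move=> u /=; rewrite eq_sym.
  by rewrite sum1_count (eq_count E) count_uniq_mem ?ft.
by rewrite (eq_big_seq _ ct) big_const_seq count_predT iter_addn_0 mulnC.
Qed.

Section Words.

Variable g : nat -> nat.
Hypothesis g_ge : forall x, x <= g x.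

Definition follows : rel nat := fun p y => y <= g p.

Section Shuffles.

Variable x : nat.

(** The insertions of [k] copies of [x] into [u] that form a path after the letter [p]. The
    recursion is nested because each letter read comes either from [u] or from the remaining copies
    of [x]. *)
Fixpoint shuffles (u : seq nat) : nat -> nat -> seq (seq nat) :=
  match u with
  | [::] => fix insert p k :=
      if k is k'.+1 then
        if x <= g p then map (cons x) (insert x k') else [::]
      else [:: [::]]
  | y :: u' => fix insert p k :=
      (if y <= g p then map (cons y) (shuffles u' y k) else [::]) ++
      (if k is k'.+1 then
         if x <= g p then map (cons x) (insert x k') else [::]
       else [::])
  end.

Lemma shuffles_cons y u p k :
  shuffles (y :: u) p k.+1 =
  (if y <= g p then map (cons y) (shuffles u y k.+1) else [::]) ++
  (if x <= g p then map (cons x) (shuffles (y :: u) x k) else [::]).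
Proof. by []. Qed.

(** A copy of [x] may stand after another copy, and any smaller letter may stand after [x], both by
    [x <= g x]. So the copies form a multiset of slots after letters [y] with [x <= g y]. Insertion
    cannot repair a forbidden step from [p] to [y], since [x > y] may not follow [p] either. *)
Lemma size_shuffles u p k : all (ltn^~ x) u ->
  size (shuffles u p k) =
  if path follows p u
  then 'C((count (fun y => x <= g y) (p :: u) + k).-1, k) else 0.
Proof.
elim: u p k => [|y u IH] p k.
  move=> _; elim: k p => [|k IHk] p; first by rewrite /= bin0.
  rewrite /=; case: ifP => _; last by rewrite /= bin_small.
  rewrite size_map IHk /= g_ge /= !addn0. by rewrite !add0n !binn.
case/andP=> yx ux; elim: k p => [|k IHk] p.
  rewrite [shuffles _ _ _]/= cats0 [path _ _ _]/= /follows.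
  by case: ifP => yg //=; rewrite size_map IH // !bin0.
rewrite shuffles_cons size_cat [path _ _ _]/= -[follows p y]/(y <= g p).
have -> : size (if y <= g p then [seq y :: i | i <- shuffles u y k.+1] else [::]) =
   if (y <= g p) && path follows y u
   then 'C((count (fun y => x <= g y) (y :: u) + k.+1).-1, k.+1) else 0.
  by case: ifP => yg //=; rewrite size_map IH.
set c := count _ (y :: u).
have -> : count (fun y => x <= g y) (p :: y :: u) = (x <= g p) + c by [].
(* When [x] may follow [p], the two choices of the next letter are the two terms of Pascal's
   rule. *)
case: (leqP x (g p)) => xp; last by rewrite addn0 add0n.
rewrite size_map IHk /= -[follows x y]/(y <= g x).
rewrite (leq_trans (ltnW yx) xp) (leq_trans (ltnW yx) (g_ge x)) /= g_ge -/c.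
case: ifP => // _; rewrite -[(x <= g y) + _]/c.
by rewrite (_ : 0 + c + k.+1 = (c + k).+1) ?addnS.
Qed.

Lemma mem_shuffles u p k w : x \notin u ->
  (w \in shuffles u p k) =
  [&& path follows p w, filter (predC1 x) w == u & count_mem x w == k].
Proof.
have consE (z : nat) s (l : seq (seq nat)) z' :
    (z :: s \in map (cons z') l) = (z == z') && (s \in l).
  apply/mapP/andP => [[s' sl [-> ->]]|[/eqP -> sl]]; first by [].
  by exists s.
have consN (l : seq (seq nat)) z' : [::] \in map (cons z') l = false.
  by apply/negP => /mapP[].
elim: u p k w => [|y u IH] p k w.
  move=> _; elim: k p w => [|k IHk] p [|z w] //=.
  - rewrite inE /=; case: (eqVneq z x) => [->|zx] /=; by rewrite ?andbF.
  - by case: ifP => // _; rewrite consN.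
  - rewrite /follows; case: (eqVneq z x) => [->|zx] /=.
      case: ifP => //= xg; rewrite consE eqxx IHk /= /follows.
      by rewrite add1n eqSS.
    by rewrite andbF; case: ifP => // _; rewrite consE (negbTE zx).
rewrite inE negb_or eq_sym => /andP[yx xu]; elim: k p w => [|k IHk] p w.
  rewrite [shuffles _ _ _]/= cats0; case: w => [|z w].
    by case: ifP => //; rewrite consN.
  have -> : (z :: w \in if y <= g p then [seq y :: i | i <- shuffles u y 0] else [::])
      = [&& y <= g p, z == y & w \in shuffles u y 0].
    by case: ifP => //= _; rewrite consE.
  rewrite IH //= /follows; case: (eqVneq z x) => [->|zx] /=.
    by rewrite add1n andbF !andbF eq_sym (negbTE yx) andbF.
  by rewrite eqseq_cons add0n; case: (eqVneq z y) => [->|] /=; rewrite ?andbF // andbA.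
rewrite shuffles_cons mem_cat.
case: w => [|z w].
  by case: ifP => _; case: ifP => _; rewrite ?consN.
have -> : (z :: w \in if y <= g p then [seq y :: i | i <- shuffles u y k.+1] else [::])
    = [&& y <= g p, z == y & w \in shuffles u y k.+1].
  by case: ifP => //= _; rewrite consE.
have -> : (z :: w \in if x <= g p
              then [seq x :: i | i <- shuffles (y :: u) x k] else [::])
    = [&& x <= g p, z == x & w \in shuffles (y :: u) x k].
  by case: ifP => //= _; rewrite consE.
rewrite IH // IHk /= /follows; case: (eqVneq z x) => [->|zx] /=.
  by rewrite eq_sym (negbTE yx) !andbF /= add1n eqSS andbA.
by rewrite andbF orbF eqseq_cons add0n; case: (eqVneq z y) => [->|] /=; rewrite ?andbF // andbA.
Qed.

Lemma shuffles_uniq u p k : x \notin u -> uniq (shuffles u p k).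
Proof.
have consI (z : nat) : injective (cons z) by move=> s s' [].
elim: u p k => [|y u IH] p k.
  move=> _; elim: k p => [|k IHk] p //=.
  by case: ifP => // _; rewrite map_inj_uniq.
rewrite inE negb_or eq_sym => /andP[yx xu]; elim: k p => [|k IHk] p.
  by rewrite /= cats0; case: ifP => // _; rewrite map_inj_uniq ?IH.
rewrite shuffles_cons cat_uniq.
apply/and3P; split.
- by case: ifP => // _; rewrite map_inj_uniq ?IH.
- apply/hasPn => w; case: ifP => // _ /mapP[s _ ->].
  by case: ifP => // _; apply/negP => /mapP[s' _ [] /eqP]; rewrite eq_sym (negbTE yx).
- by case: ifP => // _; rewrite map_inj_uniq.
Qed.

End Shuffles.

Definition words (p : nat) (M : seq nat) : seq (seq nat) :=
  [seq w <- permutations M | path follows p w].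

Lemma words_uniq p M : uniq (words p M).
Proof. exact: filter_uniq (permutations_uniq M). Qed.

Lemma mem_words p M w : (w \in words p M) = path follows p w && perm_eq w M.
Proof. by rewrite mem_filter mem_permutations. Qed.

Lemma perm_size_words p M M' : perm_eq M M' -> size (words p M) = size (words p M').
Proof.
move=> MM; apply: perm_size; apply: uniq_perm (words_uniq p M) (words_uniq p M') _ => w.
by rewrite !mem_words (permPr MM).
Qed.

Lemma filter_predC1_id (x : nat) u : x \notin u -> filter (predC1 x) u = u.
Proof.
by move=> xu; apply/all_filterP/allP => y yu /=; apply: contraNneq xu => <-.
Qed.

Lemma perm_insert (x : nat) k w M : x \notin M ->
  perm_eq w (nseq k x ++ M) =
  perm_eq (filter (predC1 x) w) M && (count_mem x w == k).
Proof.
move=> xM; apply/idP/andP => [wM|[fw /eqP cw]].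
  split.
    have := perm_filter (predC1 x) wM; rewrite filter_cat (filter_predC1_id xM).
    suff -> : filter (predC1 x) (nseq k x) = [::] by [].
    by elim: k {wM} => //= k IH; rewrite eqxx.
  have /permP -> := wM.
  by rewrite count_cat count_nseq /= eqxx mul1n (count_memPn xM) addn0.
rewrite -(permPl (permEl (perm_filterC (pred1 x) w))) -cw.
rewrite (_ : nseq _ x = filter (pred1 x) w); first by rewrite perm_cat2l.
elim: w {fw cw} => //= y w IH; case: eqP => [->|_] //=; by rewrite IH.
Qed.

(** Deleting the copies of [x] maps onto the words in [M], and each fibre is a list of shuffles,
    whose size is the same for all of them. *)
Lemma size_words_insert p x k M : all (ltn^~ x) M ->
  size (words p (nseq k x ++ M)) =
  size (words p M) * 'C((count (fun y => x <= g y) (p :: M) + k).-1, k).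
Proof.
move=> Mx; have xM : x \notin M.
  by apply/negP => /(allP Mx) /=; rewrite ltnn.
apply: (@size_fibers _ _ (filter (predC1 x))) (words_uniq p M) _ _ => [w|u].
  rewrite !mem_words perm_insert // => /and3P[pw fw cw]; rewrite fw andbT.
  have ux : all (ltn^~ x) (filter (predC1 x) w) by rewrite (perm_all _ fw).
  (* The word left after the deletion is still a path: otherwise [size_shuffles] would make this
     list empty, yet it contains [w]. *)
  have : w \in shuffles x (filter (predC1 x) w) p k.
    rewrite mem_shuffles ?pw ?eqxx //; by rewrite (perm_mem fw).
  have := size_shuffles p k ux; case: ifP => // _ /size0nil -> //.
rewrite mem_words => /andP[pu uM].
have ux : all (ltn^~ x) u by rewrite (perm_all _ uM).
have xu : x \notin u by rewrite (perm_mem uM).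
have := size_shuffles p k ux; rewrite pu /= (permP uM _) => <-.
rewrite -size_filter; apply: perm_size; apply: uniq_perm.
- exact: filter_uniq (words_uniq _ _).
- exact: shuffles_uniq.
move=> w; rewrite mem_filter mem_words mem_shuffles // perm_insert //.
case: (eqVneq (filter (predC1 x) w) u) => [->|_] /=; last by rewrite andbF.
by rewrite uM.
Qed.

(** Increasing order of insertion ensures that each new letter exceeds all letters present, as
    [size_words_insert] requires. *)
Lemma size_words p M X :
  size (words p [seq y <- M | y < X]) =
  \prod_(0 <= x < X)
    'C((count (fun y => x <= g y) (p :: [seq y <- M | y < x]) + count_mem x M).-1,
       count_mem x M).
Proof.
elim: X => [|X IH].
  by rewrite big_geq // (eq_filter (a2 := pred0)) // filter_pred0.
rewrite big_nat_recr //= -IH -size_words_insert; last first.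
  by apply/allP => y; rewrite mem_filter => /andP[].
apply: perm_size_words.
rewrite perm_sym; elim: M {IH} => //= y M IH.
rewrite [y < X.+1]ltnS [y <= X]leq_eqVlt; case: (eqVneq y X) => [->|yX] /=.
  by rewrite ltnn /= perm_cons.
rewrite add0n; case: ifP => // yX'.
apply: perm_trans
  (_ : perm_eq (y :: nseq (count_mem X M) X ++ [seq y <- M | y < X]) _).
  by rewrite -cat1s perm_catCA.
by rewrite perm_cons.
Qed.

End Words.

(** * Multinomial coefficients and blocks of [m] letters *)

(** The factorials telescope when [c 0 > 0]. The truncated predecessors agree in the degenerate
    cases too: both sides are 1 if all [c t] vanish, and 0 if [c 0] vanishes but some other [c t]
    does not. *)
Lemma multinomialE (c : nat -> nat) m :
  multinomial (\sum_(0 <= t < m.+1) c t).-1 ((c 0).-1 :: [seq c t | t <- iota 1 m]) =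
  \prod_(1 <= t < m.+1) 'C((\sum_(0 <= s < t.+1) c s).-1, c t).
Proof.
pose S k := \sum_(0 <= t < k.+1) c t.
have SS k : S k.+1 = S k + c k.+1 by rewrite /S big_nat_recr.
have S0 : S 0 = c 0 by rewrite /S big_nat1.
rewrite -[X in multinomial X.-1]/(S m).
under [RHS]eq_bigr => t _ do rewrite -[X in 'C(X.-1, _)]/(S t).
have sumE : c 0 + sumn [seq c t | t <- iota 1 m] = S m.
  by rewrite sumnE big_map /S big_ltn // /index_iota subn1.
have [c0|c0] := posnP (c 0); last first.
  have Sp k : 0 < S k by elim: k => [|k IH]; rewrite ?S0 // SS ltn_addr.
  rewrite /multinomial /=; have -> : (c 0).-1 + sumn [seq c t | t <- iota 1 m] = (S m).-1.
    by rewrite -sumE -{2}(prednK c0).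
  rewrite eqxx big_cons big_map (_ : iota 1 m = index_iota 1 m.+1);
    last by rewrite /index_iota subn1.
  have -> : (S m).-1`! = (\prod_(1 <= t < m.+1) 'C((S t).-1, c t)) *
      ((c 0).-1`! * \prod_(1 <= t < m.+1) (c t)`!).
    elim: (m) => [|k IH]; first by rewrite !big_geq // S0 mul1n muln1.
    rewrite !(big_nat_recr k.+1) //=.
    have cS : c k.+1 <= (S k.+1).-1 by rewrite SS -(prednK (Sp k)) /= leq_addl.
    rewrite -(bin_fact cS); have -> : (S k.+1).-1 - c k.+1 = (S k).-1.
      by rewrite SS -(prednK (Sp k)) addSn /= addnK.
    by rewrite IH; ring.
  by rewrite mulnK // muln_gt0 fact_gt0 prodn_gt0 // => t; exact: fact_gt0.
have [S0'|Sp] := posnP (S m).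
  have ct t : t <= m -> c t = 0.
    move=> tm; apply/eqP; rewrite -leqn0 -S0' /S (bigD1_seq t) ?iota_uniq ?leq_addr //=.
    by rewrite mem_index_iota.
  rewrite S0' [RHS]big1_seq => [|t]; last first.
    by rewrite mem_index_iota => /andP[_ tm]; rewrite ct ?bin0 //; lia.
  rewrite /multinomial /= c0 add0n.
  have -> : [seq c t | t <- iota 1 m] = nseq m 0.
    apply: (@eq_from_nth _ 0); rewrite size_map size_iota ?size_nseq // => j jm.
    by rewrite (nth_map 0) ?size_iota // nth_iota // nth_nseq jm ct.
  by rewrite sumn_nseq big_cons big_nseq iter_fix.
(* The first nonzero [c t] yields the factor ['C((c t).-1, c t)], which is 0. *)
rewrite /multinomial /= c0 add0n; case: eqP => [|_]; first by lia.
elim: (m) Sp => [|k IH]; first by rewrite S0 c0.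
rewrite big_nat_recr // SS => Sp /=.
have [Sk|/IH <-] := posnP (S k); last by rewrite mul0n.
by rewrite Sk /= [X in _ * X]bin_small ?muln0 //; lia.
Qed.

Lemma sum_count_mem (s : seq nat) a t :
  \sum_(0 <= i < t) count_mem (a + i) s = count (fun y => a <= y < a + t) s.
Proof.
elim: t => [|t IH].
  rewrite big_geq // (eq_count (a2 := pred0)) ?count_pred0 // => y /=; lia.
rewrite big_nat_recr //= IH; elim: s {IH} => //= y s IH; move: IH; lia.
Qed.

Lemma prod_blocks (F : nat -> nat) m K : F 0 = 1 ->
  \prod_(0 <= x < (K * m).+1) F x =
  \prod_(0 <= i < K) \prod_(1 <= t < m.+1) F (i * m + t).
Proof.
move=> F0; elim: K => [|K IH]; first by rewrite big_nat1 big_geq.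
have KS : (K * m).+1 <= (K.+1 * m).+1 by rewrite mulSn; lia.
rewrite [RHS]big_nat_recr //= -IH (big_cat_nat (leq0n _) KS) /=.
congr (_ * _); rewrite -{1}[(K * m).+1]addn1 addnC big_addn.
have -> : (K.+1 * m).+1 - K * m = m.+1 by rewrite mulSn; lia.
by apply: eq_bigr => t _; rewrite addnC.
Qed.

(* [shift m p] is the largest root that may follow the root [p]. *)
Definition shift (m p : nat) : nat := (p %/ m).+1 * m.

Lemma shift_ge m x : 0 < m -> x <= shift m x.
Proof. by move=> m0; apply/ltnW/ltn_ceil. Qed.

(** For [y < x = i * m + t] with [0 < t <= m], the bound [x <= shift m y] says exactly [i * m <= y].
    The slots for [x] are thus counted by the multiplicities in its own block, the starting letter 0
    included. *)
Lemma size_root_words m K M : 0 < m -> all (leq^~ (K * m)) M ->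
  size (words (shift m) 0 M) =
  \prod_(0 <= i < K)
    multinomial (\sum_(0 <= t < m.+1) count_mem (i * m + t) (0 :: M)).-1
      ((count_mem (i * m) (0 :: M)).-1 ::
       [seq count_mem (i * m + t) (0 :: M) | t <- iota 1 m]).
Proof.
move=> m0 MK.
have -> : size (words (shift m) 0 M) =
    size (words (shift m) 0 [seq y <- M | y < (K * m).+1]).
  by congr size; congr words; apply/esym/all_filterP.
rewrite size_words; last by move=> x; exact: shift_ge.
(* When copies of 0 are inserted, the starting letter offers the only slot, so the factor at 0 is
   ['C(k, k)]. *)
rewrite prod_blocks; last by rewrite (eq_filter (a2 := pred0)) // filter_pred0 binn.
apply: eq_bigr => i _.
have := multinomialE (fun t => count_mem (i * m + t) (0 :: M)) m.
rewrite /= addn0 => ->.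
apply: eq_big_nat => t /andP[t0 tm].
have E : (0 == i * m + t) = false by lia.
rewrite big_nat_recr //= E !add0n; congr 'C(_.-1, _).
congr (_ + _); transitivity (count (fun y => i * m <= y < i * m + t) (0 :: M)).
  rewrite /= count_filter; congr (_ + _).
    rewrite /shift div0n mul1n; case: (posnP i) => [->|i0]; first by lia.
    have : m <= i * m by rewrite leq_pmull.
    by lia.
  apply: eq_count => y /=.
  rewrite andbC; case: ltnP => /= yt; rewrite ?andbF // andbT.
  rewrite /shift -leq_divRL //; apply/idP/idP => H.
    have : i * m < (y %/ m).+1 * m by lia.
    by rewrite ltn_pmul2r // ltnS.
  have : i.+1 * m <= (y %/ m).+1 * m by rewrite leq_pmul2r.
  rewrite mulSn; lia.
by rewrite -sum_count_mem.
Qed.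

(** * Boards and their root words *)

From mathcomp Require Import classical_sets cardinality fsbigop.

Lemma sorted_pad n b : sorted leq (pad n b) = sorted leq b.
Proof.
rewrite /pad; elim: (n - size b) => //= d <-.
by apply: path_min_sorted; apply/allP.
Qed.

Lemma nth_pad n b i : nth 0 (pad n b) i =
  if i < n - size b then 0 else nth 0 b (i - (n - size b)).
Proof. by rewrite nth_cat size_nseq nth_nseq if_same. Qed.

Lemma pad_nonzero b : sorted leq b -> pad (size b) (filter (predC1 0) b) = b.
Proof.
elim: b => [//|h b IH] sb; have sb' := path_sorted sb.
have [h0|h0] := posnP h; rewrite /pad /=.
  rewrite h0 /= subSn ?size_filter ?count_size //= -size_filter.
  by congr cons; exact: IH.
rewrite -lt0n h0 /= (all_filterP _) ?subnn //.
apply/allP => y /(allP (order_path_min leq_trans sb)) /= hy.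
by rewrite -lt0n (leq_trans h0).
Qed.

Lemma filter_pad n (b : seq nat) : 0 \notin b -> filter (predC1 0) (pad n b) = b.
Proof.
move=> b0; rewrite filter_cat (filter_predC1_id b0).
by elim: (n - _) => //= d ->.
Qed.

Lemma board_sorted (B : board) : sorted leq B.
Proof. by case: B => b /= /andP[]. Qed.

Lemma board_pos (B : board) : 0 \notin (B : seq nat).
Proof. by case: B => b /= /andP[]. Qed.

Lemma size_leq_sumn (b : seq nat) : 0 \notin b -> size b <= sumn b.
Proof. elim: b => //= h b IH; rewrite inE negb_or => /andP[h0 /IH]; lia. Qed.

Lemma nth_size_leq_sumn (b : seq nat) j : 0 \notin b -> j < size b ->
  nth 0 b j + size b <= (sumn b + j).+1.
Proof.
elim: b j => //= h b IH j; rewrite inE negb_or => /andP[h0 b0].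
case: j => [|j] /= jb; first by rewrite addn0 addnS ltnS leq_add2l size_leq_sumn.
have := IH j b0 jb; lia.
Qed.

Section Roots.

Variable m : nat.
Hypothesis m_gt0 : 0 < m.

(** A height not divisible by [m] forces the next floor to grow, so it can only occur at the end of
    a zone. Hence [zone_rho] reduces to the remainder of the last column, and elsewhere the floor is
    the height. *)
Lemma root_vectorE (b : seq nat) (j : 'I_(size b)) :
  sorted leq b -> singleton m b ->
  root_vector m b j = ((j * m)%N%:Z - (nth 0 b j)%:Z)%R.
Proof.
move=> sb ib; rewrite ffunE.
have fle h : floorm m h <= h by exact: leq_trunc_div.
have mono i k : i <= k -> k < size b -> floorm m (nth 0 b i) <= floorm m (nth 0 b k).
  by move=> ik kb; rewrite leq_mul2r leq_div2r ?orbT // sorted_nth_leq.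
have next (i k : 'I_(size b)) : i < k ->
    floorm m (nth 0 b k) = floorm m (nth 0 b i) -> floorm m (nth 0 b i) = nth 0 b i.
  move=> ik e; apply/eqP/negP => /negP /eqP ne.
  have := ib i (leq_ltn_trans ik (ltn_ord k)) ne.
  by rewrite ltnNge -e mono.
case: ifPn => [/forall_inP last|].
  have jz : j \in zone m j.
    rewrite inE; apply/forallP => l; apply/implyP.
    by rewrite minnn maxnn -eqn_leq => /eqP/val_inj ->.
  rewrite /zone_rho (bigD1 j) //= big1 ?addn0 => [|k /andP[kz kj]].
    rewrite /rho; have := fle (nth 0 b j).
    set h := nth 0 b j; set f := floorm m h; lia.
  have ltkj : k < j by rewrite ltn_neqAle kj last.
  move: kz; rewrite inE => /forallP /(_ k); rewrite geq_minr leq_maxr => /eqP e.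
  by rewrite /rho (next k j) ?subnn.
rewrite negb_forall_in => /exists_inP[k]; rewrite inE => /forallP /(_ k).
rewrite geq_minr leq_maxr -ltnNge => /eqP e jk.
by rewrite (next j k) // subr0.
Qed.

Definition nat_roots (b : seq nat) : seq nat :=
  [seq j * m - nth 0 b j | j <- iota 0 (size b)].

Lemma size_nat_roots b : size (nat_roots b) = size b.
Proof. by rewrite size_map size_iota. Qed.

Lemma nth_nat_roots b j : j < size b -> nth 0 (nat_roots b) j = j * m - nth 0 b j.
Proof. by move=> jb; rewrite (nth_map 0) ?size_iota // nth_iota. Qed.

(** Under this condition the truncated differences in [nat_roots] are the true roots; at column 0 it
    forces height 0, hence first root 0. *)
Definition dominated (b : seq nat) : Prop := forall j, nth 0 b j <= j * m.

Lemma rook_rootsE b : dominated b -> rook_roots m b = [seq (x%:R)%R | x <- nat_roots b].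
Proof.
by move=> db; rewrite -map_comp; apply: eq_map => j /=; rewrite natrB.
Qed.

Lemma mult_of_rootsE b i : sorted leq b -> singleton m b -> dominated b ->
  mult_of (root_vector m b) i = count_mem i (nat_roots b).
Proof.
move=> sb ib db; rewrite /mult_of cardsE cardE size_filter /nat_roots.
rewrite count_map -val_enum_ord count_map enumT; apply: eq_count => j.
rewrite -[LHS]/(root_vector m b j == i%:Z)%R root_vectorE // subzn ?db //.
Qed.

Lemma nat_roots_eq0 b x s : dominated b -> nat_roots b = x :: s -> x = 0.
Proof. by case: b => //= h b _ [<- _]; rewrite mul0n sub0n. Qed.

(** The least height allowed after [h] is [h] rounded up to a multiple of [m]. Subtracting it from
    [j.+1 * m] gives the largest next root, which is [shift] of [j * m - h]. *)
Lemma board_step j h h' : h <= j * m -> h' <= j.+1 * m ->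
  (h <= h' /\ (floorm m h <> h -> floorm m h < floorm m h')) <->
  follows (shift m) (j * m - h) (j.+1 * m - h').
Proof.
move=> hj hj'; rewrite /follows /shift /floorm.
set q := h %/ m; set r := h %% m; have Eh : h = q * m + r := divn_eq h m.
have rm : r < m by exact: ltn_pmod.
have hq' : (q * m < h' %/ m * m) = (q.+1 * m <= h') by rewrite ltn_pmul2r // leq_divRL.
rewrite hq'; have [r0|r0] := posnP r.
  have qj : q <= j by rewrite -(leq_pmul2r m_gt0); lia.
  have -> : j * m - h = (j - q) * m by rewrite mulnBl; lia.
  have E : (j - q).+1 * m = j.+1 * m - q * m by rewrite -mulnBl subSn.
  rewrite mulnK // E; split; first by lia.
  by move=> H; split; lia.
have qj : q < j by rewrite -(ltn_pmul2r m_gt0); lia.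
have -> : j * m - h = (j - q.+1) * m + (m - r) by rewrite mulnBl mulSn; nia.
rewrite divnMDl // divn_small ?addn0; last by lia.
have -> : (j - q.+1).+1 * m = j.+1 * m - q.+1 * m by rewrite -mulnBl subSn.
have E1 : q.+1 * m = m + q * m by rewrite mulSn.
have E2 : q.+1 * m <= j.+1 * m by rewrite leq_pmul2r // ltnS ltnW.
by split=> [[_ H]|H]; [have := H _; lia | split=> [|_]; lia].
Qed.

Lemma valid_roots b : dominated b ->
  (sorted leq b /\ singleton m b) <-> sorted (follows (shift m)) (nat_roots b).
Proof.
move=> db; split.
  move=> [/(sortedP 0) sb ib]; apply/(sortedP 0) => i; rewrite size_nat_roots => ib'.
  rewrite !nth_nat_roots ?(ltnW ib') //; apply/board_step; rewrite ?db //.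
  by split; [exact: sb | exact: ib].
move/(sortedP 0); rewrite size_nat_roots => H.
have H' i : i.+1 < size b -> nth 0 b i <= nth 0 b i.+1 /\
    (floorm m (nth 0 b i) <> nth 0 b i ->
     floorm m (nth 0 b i) < floorm m (nth 0 b i.+1)).
  move=> ib; have := H _ ib; rewrite !nth_nat_roots ?(ltnW ib) //.
  by move/board_step; apply; exact: db.
by split; [apply/(sortedP 0) => i /H' [] | move=> i /H' []].
Qed.

Lemma singleton_pad n b : singleton m (pad n b) <-> singleton m b.
Proof.
set d := n - size b; have sz : size (pad n b) = d + size b by rewrite size_cat size_nseq.
have nd i : nth 0 (pad n b) (d + i) = nth 0 b i.
  by rewrite nth_pad ltnNge leq_addr /= addKn.
split=> H i ib.
  by have := H (d + i); rewrite -addnS !nd sz ltn_add2l; apply.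
have [id|di] := ltnP i d; first by rewrite nth_pad id /floorm div0n mul0n.
rewrite -(subnKC di) -addnS !nd; apply: H; lia.
Qed.

Lemma dominated_pad n (b : seq nat) : 0 \notin b -> sumn b < n -> dominated (pad n b).
Proof.
move=> b0 bn j; rewrite nth_pad; case: ltnP => [//|dj].
set i := j - _; have [ib|ib] := ltnP i (size b); last by rewrite nth_default.
apply: leq_trans (leq_pmulr j m_gt0).
have : i + (n - size b) = j by rewrite subnK.
move: (nth_size_leq_sumn b0 ib) (size_leq_sumn b0) bn.
lia.
Qed.

(** [shift m p] is at most [p + m]. This keeps the heights recovered from a word nonnegative. *)
Lemma follows_leq w x j : path (follows (shift m)) x w -> j <= size w ->
  nth 0 (x :: w) j <= x + j * m.
Proof.
elim: w x j => [|y w IH] x [|j] //=; rewrite ?addn0 ?leq_addr //.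
rewrite {1}/follows => /andP[xy yw] jw.
apply: leq_trans (IH y j yw jw) _; rewrite mulSn addnA leq_add2r.
apply: leq_trans xy _; rewrite /shift mulSn addnC leq_add2r; exact: leq_trunc_div.
Qed.

Lemma nat_roots_inj b b' : size b = size b' -> dominated b -> dominated b' ->
  nat_roots b = nat_roots b' -> b = b'.
Proof.
move=> sz db db' E; apply: (eq_from_nth (x0 := 0) sz) => j jb.
have := congr1 (fun s => nth 0 s j) E; rewrite /= !nth_nat_roots -?sz //.
by have := db j; have := db' j; lia.
Qed.

Definition heights_of_roots (w : seq nat) : seq nat :=
  mkseq (fun j => j * m - nth 0 w j) (size w).

Lemma dominated_heights w : dominated (heights_of_roots w).
Proof.
move=> j; have [jw|jw] := ltnP j (size w); last by rewrite nth_default ?size_mkseq.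
by rewrite nth_mkseq // leq_subr.
Qed.

Lemma heights_of_rootsK w : path (follows (shift m)) 0 w ->
  nat_roots (heights_of_roots (0 :: w)) = 0 :: w.
Proof.
move=> pw; apply: (@eq_from_nth _ 0); rewrite size_nat_roots size_mkseq // => j jw.
rewrite nth_nat_roots ?size_mkseq // nth_mkseq // subKn //.
by rewrite -[_ * _]add0n follows_leq.
Qed.

Lemma exists_board w : path (follows (shift m)) 0 w ->
  exists2 B : board, singleton m B &
    [/\ size B <= (size w).+1, dominated (pad (size w).+1 B) &
        nat_roots (pad (size w).+1 B) = 0 :: w].
Proof.
move=> pw; set b := heights_of_roots (0 :: w).
have rb : nat_roots b = 0 :: w by exact: heights_of_rootsK.
have sz : size b = (size w).+1 by rewrite size_mkseq.
have [sb ib] : sorted leq b /\ singleton m b.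
  by apply/valid_roots; rewrite ?rb //; exact: dominated_heights.
have pb := pad_nonzero sb; rewrite sz in pb.
have bB : is_board (filter (predC1 0) b).
  by rewrite /is_board (sorted_filter leq_trans) //= mem_filter /=.
exists (Board bB); first by apply/(singleton_pad (size w).+1); rewrite pb.
by split; rewrite ?pb //; [rewrite -sz size_filter count_size | exact: dominated_heights].
Qed.

End Roots.

(** * The bijection between equivalent boards and words *)

Local Open Scope classical_set_scope.
Local Open Scope card_scope.

Section Count.

Variables (m : nat) (m_gt0 : 0 < m) (B : board) (B_sing : singleton m B).

Let N := (area B).+1.

(** The first root of a fitting board is 0; it is dropped here and reappears as the starting letter
    of [words]. *)
Definition board_word (B' : board) : seq nat := behead (nat_roots m (pad N B')).

Definition fits (B' : board) : Prop := size B' <= N /\ dominated m (pad N B').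

Lemma fits_area (B' : board) : area B' = area B -> fits B'.
Proof.
move=> aB; have b0 := board_pos B'; split.
  by apply: leqW; rewrite -aB; exact: size_leq_sumn.
by apply: (dominated_pad m_gt0 b0); rewrite /N -aB.
Qed.

Lemma fits_word (B' : board) : fits B' -> nat_roots m (pad N B') = 0 :: board_word B'.
Proof.
move=> [sz db]; have : size (nat_roots m (pad N B')) = N by rewrite size_nat_roots size_pad.
rewrite /board_word; case E: nat_roots => [//|x s] _.
by rewrite (nat_roots_eq0 db E).
Qed.

Lemma equiv_fits (B' : board) : singleton m B' -> rook_equiv m B B' -> fits B'.
Proof.
move=> iB' E; apply: fits_area; apply/esym.
exact: rook_equiv_area m_gt0 (board_sorted B) B_sing (board_sorted B') iB' E.
Qed.

Lemma board_wordP (B' : board) : singleton m B' -> fits B' ->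
  rook_equiv m B B' <-> board_word B' \in words (shift m) 0 (board_word B).
Proof.
move=> iB' fB'; have fB := fits_area (erefl (area B)).
have [[sz db] [sz' db']] := (fB, fB').
have pw : path (follows (shift m)) 0 (board_word B').
  have : sorted (follows (shift m)) (nat_roots m (pad N B')).
    by apply/valid_roots => //; rewrite sorted_pad board_sorted; split=> //; apply/singleton_pad.
  by rewrite fits_word.
have E := rook_equivP m_gt0 (board_sorted B) B_sing (board_sorted B') iB' sz sz'.
rewrite mem_words pw /= perm_sym; apply: (iff_trans E).
rewrite !rook_rootsE // !fits_word //; split=> [|H].
  by move/(perm_map_inj (mulrIn (oner_neq0 _))); rewrite perm_cons.
by apply: perm_map; rewrite perm_cons.
Qed.

(** The bijection sends a board to the position of its word in the duplicate-free list of admissible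
    words. *)
Lemma card_equiv_boards :
  [set B' : board | singleton m B' /\ rook_equiv m B B'] #=
  `I_(size (words (shift m) 0 (board_word B))).
Proof.
set L := words _ _ _; apply/card_set_bijP.
exists (fun B' => index (board_word B') L); split.
- move=> B' /= [iB' E].
  by rewrite index_mem; apply/board_wordP => //; exact: equiv_fits.
- move=> B1 B2; rewrite !inE /= => -[i1 E1] [i2 E2] e.
  have f1 := equiv_fits i1 E1; have f2 := equiv_fits i2 E2.
  have L1 := (board_wordP i1 f1).1 E1; have L2 := (board_wordP i2 f2).1 E2.
  have w12 : board_word B1 = board_word B2 by rewrite -(nth_index [::] L1) e nth_index.
  (* The word determines the padded heights, and deleting their zeros recovers the board. *)
  have e12 : pad N B1 = pad N B2.
    apply: (nat_roots_inj (m := m)); rewrite ?fits_word ?w12 //.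
    + by rewrite !size_pad; [| exact: f2.1 | exact: f1.1].
    + exact: f1.2.
    + exact: f2.2.
  apply: val_inj => /=.
  by rewrite -(filter_pad N (board_pos B1)) e12 filter_pad ?board_pos.
- move=> k /= kL; set w := nth [::] L k.
  have wL : w \in L by exact: mem_nth.
  move: (wL); rewrite mem_words => /andP[pw wB].
  have szw : size w = area B.
    rewrite (perm_size wB) size_behead size_nat_roots size_pad //.
    by have [] := fits_area (erefl (area B)).
  have [B' iB' [sz db rB']] := exists_board m_gt0 pw.
  rewrite szw -/N in sz db rB'.
  have Ew : board_word B' = w by rewrite /board_word rB'.
  exists B'; last by rewrite Ew index_uniq // words_uniq.
  by split=> //; apply/board_wordP => //; rewrite Ew.
Qed.

End Count.


(* The product has finite support: its factors are 1 for i > |B|. *)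
Theorem theorem5p2 (m : nat) (hm : 0 < m) (B : board) (hB : singleton m B) :
  [set B' : board | singleton m B' /\ rook_equiv m B B'] #=
  `I_(\big[muln/1%N]_(i \in [set: nat])
        zeta_factor m (root_vector m (pad (area B).+1 B)) i).
Proof.
set N := (area B).+1.
have fB := fits_area hm (erefl (area B)); have [sz db] := fB.
have rB := fits_word fB; rewrite -/N in sz db rB.
have mult i : mult_of (root_vector m (pad N B)) i = count_mem i (0 :: board_word m B B).
  rewrite -rB mult_of_rootsE // ?sorted_pad ?board_sorted //.
  exact/singleton_pad.
(* Column [j < N] has root at most [j * m], which gives the cutoff [N] for the product. *)
have small i : N * m <= i -> mult_of (root_vector m (pad N B)) i = 0.
  move=> Ni; rewrite mult -rB; apply/count_memPn/negP => /mapP[j].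
  rewrite mem_iota size_pad // add0n => /andP[_ jN] ei.
  have : j * m < N * m by rewrite ltn_pmul2r.
  by lia.
suff <- : size (words (shift m) 0 (board_word m B B)) =
  \big[muln/1]_(i \in [set: nat]) zeta_factor m (root_vector m (pad N B)) i.
  exact: card_equiv_boards.
rewrite (@size_root_words m N) //; last first.
  apply/allP => x xB; rewrite leqNgt; apply/negP => /ltnW /small.
  by rewrite mult => /count_memPn; rewrite inE xB orbT.
rewrite -(@fsbig_widen _ _ _ _ `I_N) //; last first.
  move=> i /= [_ /negP]; rewrite -leqNgt => Ni.
  rewrite /zeta_factor.
  have z t : mult_of (root_vector m (pad N B)) (i * m + t) = 0.
    by apply: small; rewrite (leq_trans _ (leq_addr _ _)) // leq_pmul2r.
  (* All multiplicities of this block vanish; as a product of binomials with lower index 0, the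
     factor is seen to be 1. *)
  have := multinomialE (fun t => mult_of (root_vector m (pad N B)) (i * m + t)) m.
  rewrite /= addn0 => ->.
  by rewrite big1 // => t _; rewrite z bin0.
rewrite -fsbig_ord big_mkord; apply: eq_bigr => i _.
rewrite /zeta_factor mult; congr (multinomial _.-1 (_ :: _)).
  by apply: eq_bigr => t _; rewrite mult.
by apply: eq_map => t; rewrite mult.
Qed.
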